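(* Consider the majorization-minimization (MM) based hybrid beamforming algorithm defined in the context. Its convergence is guaranteed: for every initialization ${\bf F}_{\text{RF}}^{(0)}\in\mathcal{F}_{\text{RF}}$, the sequence of values of the objective $\sum_{k=1}^K\|{\bf F}_k-{\bf F}_{\text{RF}}{\bf F}_{\text{BB},k}\|_{\text{F}}^2$ generated by the iterations of the algorithm (before the final normalization step) converges. Moreover, the main complexity of the algorithm is $\mathcal{O}\big(I_{\text{out}}(I_{\text{in}}K(N_{\text{t}}N_{\text{RFT}})^3+N_{\text{t}}N_{\text{RFT}}^2)\big)$, where $I_{\text{out}}$ and $I_{\text{in}}$ are the numbers of outer and inner iterations, respectively.
   Context: Setting. Let $K,N_{\text{t}},N_{\text{RFT}},N_{\text{s}}$ be positive integers with $KN_{\text{s}}\le N_{\text{RFT}}\le N_{\text{t}}$ (number of users, transmit antennas, RF chains at the base station, streams per user). Fully digital precoders ${\bf F}_k\in\mathbb{C}^{N_{\text{t}}\times N_{\text{s}}}$, $k=1,\ldots,K$, are given. The analog precoder ${\bf F}_{\text{RF}}$ is restricted to $\mathcal{F}_{\text{RF}}=\{{\bf F}\in\mathbb{C}^{N_{\text{t}}\times N_{\text{RFT}}}: |[{\bf F}]_{n,m}|=1\ \forall n,m\}$; the digital precoders are ${\bf F}_{\text{BB},k}\in\mathbb{C}^{N_{\text{RFT}}\times N_{\text{s}}}$, and ${\bf F}_{\text{BB}}=[{\bf F}_{\text{BB},1},\ldots,{\bf F}_{\text{BB},K}]$. The underlying problem is to minimize $\sum_{k=1}^K\|{\bf F}_k-{\bf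 F}_{\text{RF}}{\bf F}_{\text{BB},k}\|_{\text{F}}^2$ subject to ${\bf F}_{\text{RF}}\in\mathcal{F}_{\text{RF}}$ and $\|{\bf F}_{\text{RF}}{\bf F}_{\text{BB}}\|_{\text{F}}^2=KN_{\text{s}}$. Notation. ${\bf f}_{\text{RF}}=\text{vec}({\bf F}_{\text{RF}})$, ${\bf Q}_k=({\bf F}_{\text{BB},k}{\bf F}_{\text{BB},k}^H)^T\otimes{\bf I}_{N_{\text{t}}}$, ${\bf e}_k=\text{vec}({\bf F}_k{\bf F}_{\text{BB},k}^H)$, and $\lambda_k$ is the largest eigenvalue of ${\bf Q}_k$. For a vector, $\exp(j\arg(\cdot))$ acts entrywise ($j=\sqrt{-1}$; the argument of a zero entry may be chosen arbitrarily). Algorithm. Choose ${\bf F}_{\text{RF}}^{(0)}\in\mathcal{F}_{\text{RF}}$. In each outer iteration: (1) With ${\bf F}_{\text{RF}}$ fixed at its current value, set ${\bf F}_{\text{BB},k}={\bf F}_{\text{RF}}^{\dagger}{\bf F}_k$ for all $k$, where $\dagger$ denotes the Moore-Penrose pseudoinverse. (2) With ${\bf F}_{\text{BB}}$ fixed, run inner iterations starting from the current ${\bf F}_{\text{RF}}$: $${\bf f}_{\text{RF}}^{(i+1)}=-\exp\Big(j\arg\Big(\frac1K\sum_{k=1}^K\big(({\bf Q}_k-\lambda_k{\bf I}){\bf f}_{\text{RF}}^{(i)}-{\bf e}_k\big)\Big)\Big),$$ until an inner stopping criterion is met; the last inner iterate becomes the new ${\bf F}_{\text{RF}}$. The outer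 iterations are repeated until an outer stopping criterion is met. Finally, ${\bf F}_{\text{BB}}$ is replaced by $\frac{\sqrt{KN_{\text{s}}}}{\|{\bf F}_{\text{RF}}{\bf F}_{\text{BB}}\|_{\text{F}}}{\bf F}_{\text{BB}}$. Complexity convention. ''Main complexity'' means the number of arithmetic operations spent on computing the largest eigenvalues $\lambda_k$ of the $N_{\text{t}}N_{\text{RFT}}\times N_{\text{t}}N_{\text{RFT}}$ matrices ${\bf Q}_k$, $k=1,\ldots,K$, in each inner iteration (an $n\times n$ eigenvalue computation costing $\mathcal{O}(n^3)$) and on computing the pseudoinverse of ${\bf F}_{\text{RF}}$ once in each outer iteration (costing $\mathcal{O}(N_{\text{t}}N_{\text{RFT}}^2)$), where $I_{\text{out}}$ outer iterations are performed, each with $I_{\text{in}}$ inner iterations. *)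

(* Defs.v *)
From HB Require Import structures.
From mathcomp Require Import all_boot all_order all_algebra.
From mathcomp Require Import sesquilinear spectral.
From mathcomp Require Import all_classical all_reals all_analysis.
From mathcomp Require Export complex mxtens.

Set Implicit Arguments.
Unset Strict Implicit.
Unset Printing Implicit Defensive.

Import Order.TTheory GRing.Theory Num.Theory.
Import numFieldNormedType.Exports.

Local Open Scope ring_scope.
Local Open Scope complex_scope.
Local Open Scope sesquilinear_scope.

Section MatrixNotions.
Variable R : realType.
Local Notation C := R[i].

Definition frobenius m n (A : 'M[C]_(m, n)) : R :=
  Num.sqrt (\sum_i \sum_j ComplexField.Normc.normc (A i j) ^+ 2).

(* Column-stacking vectorization ([mxvec] stacks rows); the entry A i j sits at
   position j * m + i, the index layout that [*t] uses, so that
   vec (A *m B) = (B^T *t 1%:M) *m vec A. *)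
Definition vec m n (A : 'M[C]_(m, n)) : 'cV[C]_(n * m) :=
  \col_k A (mxtens_unindex k).2 (mxtens_unindex k).1.

(* X is the Moore-Penrose pseudoinverse of A (the four Penrose conditions);
   MathComp's [pinvmx] is only a one-sided inverse on the row space. *)
Definition is_pseudoinverse m n (A : 'M[C]_(m, n)) (X : 'M[C]_(n, m)) : Prop :=
  [/\ A *m X *m A = A, X *m A *m X = X,
      (A *m X)^t* = A *m X & (X *m A)^t* = X *m A].

(* The order of R[i] is partial: mu <= l%:C also says that mu is real. *)
Definition is_largest_eigenvalue n (A : 'M[C]_n) (l : R) : Prop :=
  eigenvalue A l%:C /\ forall mu : C, eigenvalue A mu -> mu <= l%:C.

Definition expj (theta : R) : C := cos theta +i* sin theta.

(* Any theta is an argument of 0. *)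
Definition is_arg (z : C) (theta : R) : Prop := z = `|z| * expj theta.

Definition unimodular m n (A : 'M[C]_(m, n)) : Prop :=
  forall i j, `|A i j| = 1.

End MatrixNotions.

Fixpoint iter_rel T (r : T -> T -> Prop) (n : nat) (x y : T) : Prop :=
  if n is m.+1 then exists2 z, r x z & iter_rel r m z y else x = y.

(* The update to be performed next: the digital precoders by pseudoinverse
   (start of an outer iteration) or the analog precoder by one inner MM
   iteration. *)
Inductive phase := Digital | Analog.

Section Algorithm.
Variable R : realType.
Local Notation C := R[i].
Variables K Nt Nrf Ns : nat.

Definition objective (F : 'I_K -> 'M[C]_(Nt, Ns)) (FRF : 'M[C]_(Nt, Nrf))
    (FBB : 'I_K -> 'M[C]_(Nrf, Ns)) : R :=
  \sum_(k < K) frobenius (F k - FRF *m FBB k) ^+ 2.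

Definition Qmx (B : 'M[C]_(Nrf, Ns)) : 'M[C]_(Nrf * Nt) :=
  (B *m B^t*)^T *t (1%:M : 'M[C]_Nt).

Definition evec (Fk : 'M[C]_(Nt, Ns)) (B : 'M[C]_(Nrf, Ns)) :
    'cV[C]_(Nrf * Nt) :=
  vec (Fk *m B^t*).

Definition digital_update (F : 'I_K -> 'M[C]_(Nt, Ns)) (FRF : 'M[C]_(Nt, Nrf))
    (FBB' : 'I_K -> 'M[C]_(Nrf, Ns)) : Prop :=
  exists2 X, is_pseudoinverse FRF X & forall k, FBB' k = X *m F k.

Definition analog_update (F : 'I_K -> 'M[C]_(Nt, Ns))
    (FBB : 'I_K -> 'M[C]_(Nrf, Ns)) (FRF FRF' : 'M[C]_(Nt, Nrf)) : Prop :=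
  exists (lambda : 'I_K -> R) (theta : 'I_(Nrf * Nt) -> R),
    let z := K%:R^-1 *: \sum_(k < K)
      ((Qmx (FBB k) - ((lambda k)%:C)%:M) *m vec FRF - evec (F k) (FBB k)) in
    [/\ forall k, is_largest_eigenvalue (Qmx (FBB k)) (lambda k),
        forall i, is_arg (z i 0) (theta i)
      & vec FRF' = - \col_i expj (theta i)].

Record config := Config {
  next_phase : phase;
  analog : 'M[C]_(Nt, Nrf);
  digital : 'I_K -> 'M[C]_(Nrf, Ns);
  cost : nat (* operations spent so far on eigenvalues and pseudoinverses *)
}.

(* eig_cost A, pinv_cost A: number of arithmetic operations of the eigenvalue,
   resp. pseudoinverse, routine on the input A. *)
Variable eig_cost : forall n, 'M[C]_n -> nat.
Variable pinv_cost : forall m n, 'M[C]_(m, n) -> nat.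
Variable F : 'I_K -> 'M[C]_(Nt, Ns).

(* The phase p after an analog update is unconstrained: p = Digital when the
   inner stopping criterion is met and p = Analog otherwise, so every inner
   stopping criterion (even a history-dependent one) is covered. *)
Inductive step : config -> config -> Prop :=
| DigitalStep FRF FBB FBB' c :
    digital_update F FRF FBB' ->
    step (Config Digital FRF FBB c)
         (Config Analog FRF FBB' (c + pinv_cost FRF)%N)
| AnalogStep FRF FRF' FBB c p :
    analog_update F FBB FRF FRF' ->
    step (Config Analog FRF FBB c)
         (Config p FRF' FBB (c + \sum_(k < K) eig_cost (Qmx (FBB k)))%N).

(* The initial digital precoders are irrelevant: the first step overwrites
   them. *)
Definition initial (F0 : 'M[C]_(Nt, Nrf)) (s : config) : Prop :=
  [/\ next_phase s = Digital, analog s = F0 & cost s = 0%N].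

Definition run (F0 : 'M[C]_(Nt, Nrf)) (s : nat -> config) : Prop :=
  initial F0 (s 0%N) /\ forall n, step (s n) (s n.+1).

(* One outer iteration with exactly Iin inner iterations. *)
Definition outer_iteration (Iin : nat) (s s' : config) : Prop :=
  exists s1, [/\ next_phase s = Digital, step s s1,
    iter_rel (fun t t' => next_phase t = Analog /\ step t t') Iin s1 s'
    & next_phase s' = Digital].

Definition normalization (s s' : config) : Prop :=
  [/\ analog s' = analog s, cost s' = cost s
    & forall k, digital s' k =
        (Num.sqrt (K * Ns)%N%:R /
          frobenius (analog s *m \mxrow_(l < K) digital s l))%:C *: digital s k].

(* A complete terminating execution, with result s. *)
Definition execution (Iout Iin : nat) (F0 : 'M[C]_(Nt, Nrf)) (s : config) :
    Prop :=
  exists s0 s1, [/\ initial F0 s0, iter_rel (outer_iteration Iin) Iout s0 s1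
    & normalization s1 s].

End Algorithm.

(* Main.v *)
(** Every step decreases the objective, which is nonnegative. The digital update
    solves a least squares problem. For the analog update, [Q_k - lambda_k I] is
    negative semidefinite, so f^H (Q_k - lambda_k I) f lies below its tangent at
    the current iterate; on vectors with unimodular entries lambda_k |f|^2 is
    constant, so the objective is majorized by an affine function of f, and
    opposing the phases of its gradient minimizes this function. *)

Require Import Defs.
From mathcomp Require Import all_boot all_order all_algebra.
From mathcomp Require Import sesquilinear spectral.
From mathcomp Require Import all_classical all_reals all_analysis.
From mathcomp Require Import ring.
Import Order.TTheory GRing.Theory Num.Theory.
Import numFieldNormedType.Exports.
Local Open Scope classical_set_scope.
Local Open Scope ring_scope.
Local Open Scope sesquilinear_scope.

(** * Frobenius inner product and the descent inequalities behind both updates *)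

Section FrobeniusProduct.
Set Implicit Arguments.
Unset Strict Implicit.
Context {C : numClosedFieldType}.

Lemma adjmxM m n p (A : 'M[C]_(m, n)) (B : 'M[C]_(n, p)) :
  (A *m B)^t* = B^t* *m A^t*.
Proof. by rewrite trmx_mul map_mxM. Qed.

(** The Frobenius inner product, conjugate-linear in [B]; keeping it in [C] makes real parts appear
    as [fprod A B + fprod B A]. *)
Definition fprod m n (A B : 'M[C]_(m, n)) : C := \tr (A *m B^t*).

Lemma fprodE m n (A B : 'M[C]_(m, n)) :
  fprod A B = \sum_i \sum_j A i j * (B i j)^*.
Proof.
by apply: eq_bigr => i _; rewrite mxE; apply: eq_bigr => j _; rewrite !mxE.
Qed.

Lemma fprodBl m n (A A' B : 'M[C]_(m, n)) :
  fprod (A - A') B = fprod A B - fprod A' B.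
Proof. by rewrite /fprod mulmxBl raddfB. Qed.

Lemma fprodC m n (A B : 'M[C]_(m, n)) : fprod B A = (fprod A B)^*.
Proof.
rewrite !fprodE rmorph_sum; apply: eq_bigr => i _.
rewrite rmorph_sum; apply: eq_bigr => j _.
by rewrite rmorphM /= conjCK mulrC.
Qed.

Lemma fprodBr m n (A B B' : 'M[C]_(m, n)) :
  fprod A (B - B') = fprod A B - fprod A B'.
Proof. by rewrite fprodC fprodBl rmorphB /= -!fprodC. Qed.

Lemma fprodNl m n (A B : 'M[C]_(m, n)) : fprod (- A) B = - fprod A B.
Proof. by rewrite /fprod mulNmx raddfN. Qed.

Lemma fprodNr m n (A B : 'M[C]_(m, n)) : fprod A (- B) = - fprod A B.
Proof. by rewrite fprodC fprodNl rmorphN /= -fprodC. Qed.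

Lemma fprodZl m n a (A B : 'M[C]_(m, n)) : fprod (a *: A) B = a * fprod A B.
Proof. by rewrite /fprod -scalemxAl mxtraceZ. Qed.

Lemma fprod_suml m n (I : finType) (A : I -> 'M[C]_(m, n)) B :
  fprod (\sum_k A k) B = \sum_k fprod (A k) B.
Proof. by rewrite /fprod mulmx_suml raddf_sum. Qed.

Lemma fprod_ge0 m n (A : 'M[C]_(m, n)) : 0 <= fprod A A.
Proof.
by rewrite fprodE; apply: sumr_ge0 => i _; apply: sumr_ge0 => j _;
  exact: mul_conjC_ge0.
Qed.

Lemma fprod_mulr m n p (A : 'M[C]_(m, n)) (B : 'M[C]_(n, p)) D :
  fprod (A *m B) D = fprod A (D *m B^t*).
Proof. by rewrite /fprod adjmxM trmxCK mulmxA. Qed.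

Lemma fprod_mull m n p (A : 'M[C]_(m, n)) (B : 'M[C]_(n, p)) D :
  fprod (A *m B) D = fprod B (A^t* *m D).
Proof. by rewrite /fprod adjmxM trmxCK -mulmxA mxtrace_mulC !mulmxA. Qed.

Lemma fprodBB m n (A B : 'M[C]_(m, n)) :
  fprod (A - B) (A - B) = fprod A A + fprod B B - (fprod A B + fprod B A).
Proof. rewrite fprodBl !fprodBr; ring. Qed.

Lemma fprod_unimodular m n (A : 'M[C]_(m, n)) :
  (forall i j, `|A i j| = 1) -> fprod A A = (m * n)%:R.
Proof.
move=> A1; rewrite fprodE (eq_bigr (fun=> n%:R)) => [|i _].
  by rewrite sumr_const card_ord mulnC mulrnA.
rewrite (eq_bigr (fun=> 1)) => [|j _]; first by rewrite sumr_const card_ord.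
by rewrite -normCK A1 expr1n.
Qed.

(* A real upper bound of the spectrum bounds the Rayleigh quotients: expand x
   on an orthonormal eigenbasis. *)
Lemma rayleigh_le n (A : 'M[C]_n) (l : C) (x : 'cV[C]_n) :
  A^t* = A -> (forall mu, eigenvalue A mu -> mu <= l) ->
  fprod (A *m x) x <= l * fprod x x.
Proof.
move=> Aherm Al; have : A \is hermsymmx.
  by apply/is_hermitianmxP; rewrite expr0 scale1r.
move/hermitian_normalmx/orthomx_spectralP.
have Pu := spectral_unitarymx A; have Pi := spectral_unit A.
set P := spectralmx A in Pu Pi *; set d := spectral_diag A => defA.
(* Row [i] of the unitary [P] is a left eigenvector of [A] for [d 0 i]; it is nonzero because [P] is
   invertible. *)
have d_le i : d 0 i <= l.
  apply/Al/eigenvalueP; exists (row i P).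
    rewrite -row_mul {1}defA !mulmxA mulmxV // mul1mx.
    by apply/rowP => j; rewrite mul_diag_mx !mxE.
  apply: contraTneq Pi => Pi0; apply/negP => Pi.
  have: row i P *m invmx P = 0 by rewrite Pi0 mul0mx.
  rewrite -row_mul mulmxV // => /rowP/(_ i); rewrite !mxE eqxx => /eqP.
  by rewrite oner_eq0.
have -> : fprod x x = fprod (P *m x) (P *m x).
  by rewrite fprod_mull mulmxA -invmx_unitary // mulVmx // mul1mx.
rewrite {1}defA invmx_unitary // -!mulmxA fprod_mull trmxCK !fprodE mulr_sumr.
apply: ler_sum => i _; rewrite !big_ord1 mul_diag_mx !mxE -mulrA.
by apply: ler_wpM2r; rewrite ?mul_conjC_ge0.
Qed.

(* With [X] a pseudoinverse of [A], [A X] is the orthogonal projector on the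
   range of [A]. *)
Lemma least_squares m n p (A : 'M[C]_(m, n)) (X : 'M[C]_(n, m))
    (G : 'M[C]_(m, p)) B :
  A *m X *m A = A -> (A *m X)^t* = A *m X ->
  fprod (G - A *m (X *m G)) (G - A *m (X *m G))
    <= fprod (G - A *m B) (G - A *m B).
Proof.
move=> AXA AXh; set V := G - A *m (X *m G); set W := A *m (X *m G - B).
(* Normal equations: the residual [V] is orthogonal to the range of [A], which contains [W], so
   Pythagoras applies to [V + W]. *)
have AV : A^t* *m V = 0.
  have AAX : A^t* *m (A *m X) = A^t* by rewrite -[in RHS]AXA adjmxM AXh.
  by rewrite mulmxBr -{1}AAX !mulmxA subrr.
have -> : G - A *m B = V - (- W).
  by rewrite /V /W opprK mulmxBr addrA subrK.
have WV : fprod (- W) V = 0.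
  by rewrite -mulmxN fprod_mull AV /fprod trmx0 map_mx0 mulmx0 mxtrace0.
have VW : fprod V (- W) = 0 by rewrite fprodC WV rmorph0.
rewrite [leRHS]fprodBB VW WV addr0 subr0 lerDl.
exact: fprod_ge0.
Qed.

(* Opposing the phases of [Z] minimizes Re <Z, A'> among unimodular A'. *)
Lemma phase_descent m n (A A' Z : 'M[C]_(m, n)) (u : 'I_m -> 'I_n -> C) :
  (forall i j, `|A i j| = 1) -> (forall i j, `|u i j| = 1) ->
  (forall i j, Z i j = `|Z i j| * u i j) -> (forall i j, A' i j = - u i j) ->
  fprod Z (A' - A) + fprod (A' - A) Z <= 0.
Proof.
move=> A1 u1 Zu A'u; rewrite !fprodE -big_split; apply: sumr_le0 => i _.
rewrite -big_split; apply: sumr_le0 => j _ /=; rewrite !mxE A'u.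
have uu : u i j * (u i j)^* = 1 by rewrite -normCK u1 expr1n.
have Zr : (`|Z i j|)^* = `|Z i j| by apply/conj_Creal/normr_real.
set w := Z i j * (A i j)^*.
(* As [Z i j] has phase [u i j], the new entry contributes twice the modulus of [Z i j] and the old
   one 2 Re [w]; the sum is nonnegative because [w] has that same modulus. *)
have -> : Z i j * (- u i j - A i j)^* + (- u i j - A i j) * (Z i j)^* =
    - (`|Z i j| * 2 + (w + w^*)).
  rewrite /w; move: Zr; move: (Zu i j); set r := `|Z i j| => -> rr.
  rewrite !rmorphM rmorphB rmorphN /= conjCK rr.
  ring: uu.
rewrite oppr_le0.
have nw : `|w| = `|Z i j| by rewrite normrM norm_conjC A1 mulr1.
have := (leif_normC_Re_Creal w).1; rewrite nw => Re_le.
have : - `|Z i j| <= 'Re w by apply: real_lerNnormlW => //; exact: Creal_Re.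
rewrite -[_ <= _]subr_ge0 opprK => Re_ge.
have -> : w + w^* = 2 * 'Re w.
  by rewrite ReE mulrC divfK // pnatr_eq0.
by rewrite mulrC -mulrDr addrC mulr_ge0.
Qed.

(* On matrices of the same norm as [A], the quadratic objective is majorized by
   its value at [A] plus 2 Re <Z, A' - A>. *)
Lemma mm_descent m n p (I : finType) (G : I -> 'M[C]_(m, p))
    (B : I -> 'M[C]_(n, p)) (l : I -> C) (A A' : 'M[C]_(m, n))
    (Z := \sum_k ((A *m B k - G k) *m (B k)^t* - l k *: A)) :
  (forall k, l k \is Num.real) ->
  (forall k (D : 'M[C]_(m, n)),
    fprod (D *m B k) (D *m B k) <= l k * fprod D D) ->
  fprod A' A' = fprod A A ->
  fprod Z (A' - A) + fprod (A' - A) Z <= 0 ->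
  \sum_k fprod (G k - A' *m B k) (G k - A' *m B k)
    <= \sum_k fprod (G k - A *m B k) (G k - A *m B k).
Proof.
move=> lr lB A'A Zle; rewrite -subr_le0 -sumrB; apply: le_trans Zle.
set D := A' - A.
(* Equal norms of [A] and [A'] make the curvature term [l k * fprod D D] linear in [D]; this
   produces the summand [- l k *: A] of [Z]. *)
have DD : fprod D D = - (fprod A D + fprod D A).
  by rewrite [LHS]fprodBB A'A fprodBl fprodBr; ring.
rewrite [fprod D Z]fprodC fprod_suml rmorph_sum -big_split.
apply: ler_sum => k _ /=.
have -> : G k - A' *m B k = (G k - A *m B k) - D *m B k.
  by rewrite mulmxBl opprB addrA subrK.
set E := G k - A *m B k.
have -> : A *m B k - G k = - E by rewrite opprB.
rewrite fprodBB -fprodC mulNmx.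
rewrite [fprod (_ - _ *: A) D]fprodBl [fprod D (_ - _ *: A)]fprodBr.
rewrite fprodZl [fprod D (_ *: _)]fprodC fprodZl rmorphM /= -fprodC.
have -> : (l k)^* = l k by apply/conj_Creal.
have EB : fprod (E *m (B k)^t*) D = fprod E (D *m B k).
  by rewrite fprod_mulr trmxCK.
rewrite fprodNl fprodNr [fprod D (_ *m _)]fprodC EB -fprodC.
have := lB k D; rewrite DD.
move: (fprod (D *m B k) _) (fprod E E) => q e.
move: (fprod E (D *m B k)) (fprod _ E) => a b q_le; rewrite -subr_ge0.
(* After expansion around [E], the gap between majorant and objective is exactly the slack in the
   curvature bound [lB k D]. *)
rewrite [X in 0 <= X](_ : _ = l k * - (fprod A D + fprod D A) - q).
  by rewrite subr_ge0.
ring.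
Qed.

End FrobeniusProduct.

(** * From the vectorized updates to matrices, and descent of each update *)

Section Algorithm.
Set Implicit Arguments.
Unset Strict Implicit.
Context {R : realType}.
Local Notation C := R[i].

Lemma frobenius_sqr m n (A : 'M[C]_(m, n)) :
  ((frobenius A ^+ 2)%:C)%C = fprod A A.
Proof.
rewrite sqr_sqrtr; last by do 2![apply: sumr_ge0 => ? _]; exact: sqr_ge0.
rewrite fprodE rmorph_sum; apply: eq_bigr => i _.
rewrite rmorph_sum; apply: eq_bigr => j _.
by rewrite rmorphXn /= -normCK.
Qed.

Lemma sum_mxtens m n (f : 'I_m -> 'I_n -> C) :
  \sum_(k < m * n) f (mxtens_unindex k).1 (mxtens_unindex k).2 =
  \sum_i \sum_j f i j.
Proof.
rewrite pair_bigA (reindex (@mxtens_index m n)).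
  by apply: eq_bigr => p _; rewrite mxtens_indexK.
by exists (@mxtens_unindex m n) => p _; rewrite ?mxtens_indexK ?mxtens_unindexK.
Qed.

Lemma fprod_vec m n (A B : 'M[C]_(m, n)) : fprod (vec A) (vec B) = fprod A B.
Proof.
rewrite !fprodE [RHS]exchange_big.
apply: etrans _ (sum_mxtens (fun j i => A i j * (B i j)^*)).
by apply: eq_bigr => k _; rewrite big_ord1 !mxE.
Qed.

(** The identity factor of the Kronecker product keeps only the row index [i], so the sum over pairs
    collapses to a matrix product. *)
Lemma Qmx_vec Nt Nrf Ns (B : 'M[C]_(Nrf, Ns)) (A : 'M[C]_(Nt, Nrf)) :
  Qmx Nt B *m vec A = vec (A *m (B *m B^t*)).
Proof.
apply/colP => k; case: (mxtens_indexP k) => j i {k}.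
rewrite [LHS]mxE [RHS]mxE mxtens_indexK /= [RHS]mxE; set S := B *m B^t*.
transitivity (\sum_(k < Nrf * Nt)
  (S (mxtens_unindex k).1 j * ((i == (mxtens_unindex k).2)%:R *
     A (mxtens_unindex k).2 (mxtens_unindex k).1))).
  by apply: eq_bigr => k _; rewrite !mxE mxtens_indexK mulrA.
apply: etrans (sum_mxtens (fun a b => S a j * ((i == b)%:R * A b a))) _.
apply: eq_bigr => a _; rewrite (bigD1 i) //= eqxx mul1r big1 ?addr0 1?mulrC //.
by move=> b /negPf; rewrite eq_sym => ->; rewrite mul0r mulr0.
Qed.

Lemma Qmx_herm Nt Nrf Ns (B : 'M[C]_(Nrf, Ns)) :
  (Qmx Nt B)^t* = Qmx Nt B.
Proof.
rewrite /Qmx trmx_tens map_mxT trmx1 map_mx1; congr (_ *t _).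
by rewrite -map_trmx adjmxM trmxCK.
Qed.

(** The left side is the Hermitian form of [Qmx Nt B] at [vec D], so [rayleigh_le] applies. *)
Lemma Qmx_curvature Nt Nrf Ns (B : 'M[C]_(Nrf, Ns)) (l : R)
    (D : 'M[C]_(Nt, Nrf)) :
  is_largest_eigenvalue (Qmx Nt B) l ->
  fprod (D *m B) (D *m B) <= (l%:C)%C * fprod D D.
Proof.
move=> [_ lmax]; have := rayleigh_le (vec D) (Qmx_herm Nt B) lmax.
rewrite Qmx_vec !fprod_vec; congr (_ <= _).
by rewrite mulmxA fprod_mulr trmxCK.
Qed.

Lemma normc_expj (t : R) : `|expj t| = 1.
Proof. by rewrite normc_def /= cos2Dsin2 sqrtr1. Qed.

Lemma objective_fprod K Nt Nrf Ns (F : 'I_K -> 'M[C]_(Nt, Ns))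
    (A : 'M[C]_(Nt, Nrf)) B :
  ((objective F A B)%:C)%C = \sum_k fprod (F k - A *m B k) (F k - A *m B k).
Proof.
by rewrite rmorph_sum; apply: eq_bigr => k _; rewrite -frobenius_sqr.
Qed.

Lemma digital_update_le K Nt Nrf Ns (F : 'I_K -> 'M[C]_(Nt, Ns))
    (A : 'M[C]_(Nt, Nrf)) B B' :
  digital_update F A B' -> objective F A B' <= objective F A B.
Proof.
case=> X [AXA _ AXh _] B'E; rewrite -lecR !objective_fprod.
by apply: ler_sum => k _; rewrite B'E; exact: least_squares.
Qed.

Lemma analog_update_unimodular K Nt Nrf Ns (F : 'I_K -> 'M[C]_(Nt, Ns))
    (A A' : 'M[C]_(Nt, Nrf)) B :
  analog_update F B A A' -> unimodular A'.
Proof.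
case=> l [t] /= [_ _ /colP vecA'] i j.
have := vecA' (mxtens_index (j, i)); rewrite !mxE mxtens_indexK /= => ->.
by rewrite normrN normc_expj.
Qed.

Lemma analog_update_le K Nt Nrf Ns (F : 'I_K -> 'M[C]_(Nt, Ns))
    (A A' : 'M[C]_(Nt, Nrf)) B :
  (0 < K)%N -> unimodular A -> analog_update F B A A' ->
  objective F A' B <= objective F A B.
Proof.
move=> K0 A1 AA'; have A'1 := analog_update_unimodular AA'.
rewrite -lecR (objective_fprod F A' B) (objective_fprod F A B).
case: AA' => l [t] /= [l_max t_arg vecA'].
(* The matrix whose [vec] is K times the vector of which the algorithm takes the phases. *)
pose Z := \sum_k ((A *m B k - F k) *m (B k)^t* - (l k)%:C%C *: A).
apply: (mm_descent (l := fun k => (l k)%:C%C)) => [k|k D||].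
- by apply/complex_realP; exists (l k).
- exact: Qmx_curvature.
- by rewrite !fprod_unimodular.
rewrite -/Z.
have vecZ : \sum_k ((Qmx Nt (B k) - ((l k)%:C%C)%:M) *m vec A
    - evec (F k) (B k)) = vec Z.
  apply/colP => i; rewrite !mxE !summxE; apply: eq_bigr => k _.
  by rewrite mulmxBl Qmx_vec mul_scalar_mx mulmxA mulmxBl !mxE addrAC.
rewrite vecZ in t_arg.
have K1 : (K%:R : C) != 0 by rewrite pnatr_eq0 -lt0n.
(* The phases are known for the average [K%:R^-1 *: Z]; the positive factor [K] is pulled out of the
   inequality. *)
have ZK : Z = K%:R *: (K%:R^-1 *: Z) by rewrite scalerA divff // scale1r.
rewrite ZK.
rewrite [fprod _ (_ *: _)]fprodC fprodZl rmorphM rmorph_nat /= -fprodC -mulrDr.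
rewrite mulr_ge0_le0 ?ler0n //.
apply: (phase_descent (u := fun i j => expj (t (mxtens_index (j, i))))) => //.
- by move=> i j; exact: normc_expj.
- move=> i j; have := t_arg (mxtens_index (j, i)).
  by rewrite /is_arg !mxE mxtens_indexK.
- move=> i j; have /colP/(_ (mxtens_index (j, i))) := vecA'.
  by rewrite !mxE mxtens_indexK.
Qed.

(** * Convergence along runs, then the operation count *)

Section Run.
Variables K Nt Nrf Ns : nat.
Variable eig_cost : forall n, 'M[C]_n -> nat.
Variable pinv_cost : forall m n, 'M[C]_(m, n) -> nat.
Variable F : 'I_K -> 'M[C]_(Nt, Ns).
Local Notation step := (@step R K Nt Nrf Ns eig_cost pinv_cost F).

Lemma step_unimodular (s s' : config R K Nt Nrf Ns) :
  step s s' -> unimodular (analog s) -> unimodular (analog s').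
Proof. by case=> //= A A' B c p /analog_update_unimodular. Qed.

Lemma step_le (s s' : config R K Nt Nrf Ns) :
  (0 < K)%N -> unimodular (analog s) -> step s s' ->
  objective F (analog s') (digital s') <= objective F (analog s) (digital s).
Proof.
move=> K0; move=> + ss'; case: ss' => /=.
  by move=> A B B' c /digital_update_le.
by move=> A A' B c p /analog_update_le AA' A1; exact: AA'.
Qed.

Lemma objective_ge0 (A : 'M[C]_(Nt, Nrf)) B : 0 <= objective F A B.
Proof. by apply: sumr_ge0 => k _; exact: sqr_ge0. Qed.

(** A nonincreasing sequence bounded below by 0. Unimodularity is carried along the run because
    descent of the analog update requires it. *)
Lemma run_objective_cvg F0 (s : nat -> config R K Nt Nrf Ns) :
  (0 < K)%N -> unimodular F0 -> run eig_cost pinv_cost F F0 s ->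
  cvgn (fun n => objective F (analog (s n.+1)) (digital (s n.+1))).
Proof.
move=> K0 F01 [[_ s0 _] s_step].
have s1 n : unimodular (analog (s n)).
  by elim: n => [|n IHn]; [rewrite s0 | exact: step_unimodular IHn].
apply: nonincreasing_is_cvgn.
  by apply/nonincreasing_seqP => n; exact: step_le.
by exists 0 => _ [n _ <-]; exact: objective_ge0.
Qed.

Variables c1 c2 : nat.
Hypothesis eig_le : forall (n : nat) (A : 'M[C]_n),
  (0 < n)%N -> (eig_cost A <= c1 * n ^ 3)%N.
Hypothesis pinv_le : forall (m n : nat) (A : 'M[C]_(m, n)),
  (0 < n)%N -> (n <= m)%N -> (pinv_cost A <= c2 * (m * n ^ 2))%N.
Hypothesis Nt_gt0 : (0 < Nt)%N.
Hypothesis Nrf_gt0 : (0 < Nrf)%N.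
Hypothesis Nrf_le_Nt : (Nrf <= Nt)%N.

Lemma analog_step_cost (s s' : config R K Nt Nrf Ns) :
  next_phase s = Analog -> step s s' ->
  (cost s' <= cost s + c1 * (K * (Nt * Nrf) ^ 3))%N.
Proof.
move=> + ss'; case: ss' => //= A A' B c p _ _; rewrite leq_add2l mulnCA.
rewrite -[X in (_ <= X * _)%N](card_ord K) -sum_nat_const leq_sum // => k _.
by rewrite [(Nt * _)%N]mulnC eig_le // muln_gt0 Nrf_gt0.
Qed.

Lemma inner_cost n (s s' : config R K Nt Nrf Ns) :
  iter_rel (fun t t' => next_phase t = Analog /\ step t t') n s s' ->
  (cost s' <= cost s + n * (c1 * (K * (Nt * Nrf) ^ 3)))%N.
Proof.
elim: n s => [|n IHn] s /=; first by move=> ->; rewrite addn0.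
case=> t [s_analog st] /IHn /leq_trans; apply.
by rewrite mulSn addnA leq_add2r; exact: analog_step_cost.
Qed.

(** One pseudoinverse plus [Iin] rounds of [K] eigenvalue computations; [maxn c1 c2] dominates both
    constants. *)
Lemma outer_cost Iin (s s' : config R K Nt Nrf Ns) :
  outer_iteration eig_cost pinv_cost F Iin s s' ->
  (cost s' <= cost s +
    maxn c1 c2 * (Iin * K * (Nt * Nrf) ^ 3 + Nt * Nrf ^ 2))%N.
Proof.
case=> t [s_digital st /inner_cost s'_le _]; apply: leq_trans s'_le _.
have {s_digital st} : (cost t <= cost s + c2 * (Nt * Nrf ^ 2))%N.
  by case: st s_digital => //= A B B' c _ _; rewrite leq_add2l pinv_le.
move=> t_le; apply: leq_trans (leq_add t_le (leqnn _)) _.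
rewrite -addnA leq_add2l addnC mulnDr leq_add //.
  by rewrite mulnCA -mulnA leq_mul2r leq_maxl orbT.
by rewrite leq_mul2r leq_maxr orbT.
Qed.

Lemma execution_cost Iout Iin F0 (s : config R K Nt Nrf Ns) :
  execution eig_cost pinv_cost F Iout Iin F0 s ->
  (cost s <= maxn c1 c2 *
    (Iout * (Iin * K * (Nt * Nrf) ^ 3 + Nt * Nrf ^ 2)))%N.
Proof.
case=> s0 [s1 [[_ _ cost0] s01 [_ -> _]]].
set X := (_ + Nt * _)%N.
(* Stated relative to [cost s0], since the induction moves the starting state past configurations of
   zero cost. *)
suff: (cost s1 <= cost s0 + maxn c1 c2 * (Iout * X))%N by rewrite cost0.
elim: Iout s0 s01 {cost0} => [|n IHn] s0 /=.
  by move=> ->; rewrite leq_addr.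
case=> t /outer_cost t_le /IHn /leq_trans; apply.
by rewrite mulSn [(_ * (X + _))%N]mulnDr addnA leq_add2r.
Qed.

End Run.
End Algorithm.

Theorem theorem2 (R : realType)
    (eig_cost : forall n : nat, 'M[R[i]]_n -> nat)
    (pinv_cost : forall m n : nat, 'M[R[i]]_(m, n) -> nat) :
  (forall (K Nt Nrf Ns : nat) (F : 'I_K -> 'M[R[i]]_(Nt, Ns))
      (F0 : 'M[R[i]]_(Nt, Nrf)) (s : nat -> config R K Nt Nrf Ns),
    (0 < K)%N -> (0 < Nt)%N -> (0 < Nrf)%N -> (0 < Ns)%N ->
    (K * Ns <= Nrf)%N -> (Nrf <= Nt)%N ->
    unimodular F0 ->
    run eig_cost pinv_cost F F0 s ->
    cvgn (fun n : nat => objective F (analog (s n.+1)) (digital (s n.+1))))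
  /\
  ((exists c : nat, forall (n : nat) (A : 'M[R[i]]_n),
      (0 < n)%N -> (eig_cost n A <= c * n ^ 3)%N) ->
   (exists c : nat, forall (m n : nat) (A : 'M[R[i]]_(m, n)),
      (0 < n)%N -> (n <= m)%N -> (pinv_cost m n A <= c * (m * n ^ 2))%N) ->
   exists c : nat,
     forall (K Nt Nrf Ns Iout Iin : nat) (F : 'I_K -> 'M[R[i]]_(Nt, Ns))
        (F0 : 'M[R[i]]_(Nt, Nrf)) (s : config R K Nt Nrf Ns),
      (0 < K)%N -> (0 < Nt)%N -> (0 < Nrf)%N -> (0 < Ns)%N ->
      (K * Ns <= Nrf)%N -> (Nrf <= Nt)%N ->
      unimodular F0 ->
      execution eig_cost pinv_cost F Iout Iin F0 s ->
      (cost s <= c * (Iout * (Iin * K * (Nt * Nrf) ^ 3 + Nt * Nrf ^ 2)))%N).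
Proof.
split=> [K Nt Nrf Ns F F0 s K0 _ _ _ _ _ F01 s_run|[c1 eig_le] [c2 pinv_le]].
  exact: run_objective_cvg K0 F01 s_run.
(* The constant is fixed before the dimensions and iteration counts, so the bound is uniform in
   them. *)
exists (maxn c1 c2) => K Nt Nrf Ns Iout Iin F F0 s _ Nt0 Nrf0 _ _ NrfNt _.
exact: execution_cost.
Qed.
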